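(* The $0$-th moment $\mathcal H_0^{(\lambda)}=\sum_{x=0}^\infty W^{(\lambda)}(x)$ of the weight $W^{(\lambda)}(x)=\frac{a^x}{x!}(I+A)^{x+\lambda}T^{(\lambda)}(I+A^* )^{x+\lambda}$ has the LDU factorization $$\mathcal H_0^{(\lambda)}=L_0^{-1}(I+A)^\lambda\mathcal D_0^{(\lambda)}(I+A^* )^\lambda(L_0^* )^{-1},$$ where $\mathcal D_0^{(\lambda)}$ is the diagonal matrix with entries $$(\mathcal D_0^{(\lambda)})_{jj}=\mu_j^2a^je^a\sum_{\ell=1}^j\frac{\delta_\ell^{(\lambda)}}{\mu_\ell^2}\frac{a^{-\ell}}{(j-\ell)!},\qquad 1\le j\le N.$$
   Context: $N\ge1$, $a>0$, $\lambda\in\mathbb N_0=\{0,1,2,\dots\}$; $\mu_1,\dots,\mu_N>0$ and $\delta_1^{(\lambda)},\dots,\delta_N^{(\lambda)}>0$ are arbitrary. $A$ is the $N\times N$ matrix with $A_{j,k}=\mu_j/\mu_{j-1}$ if $j=k+1$ and $A_{j,k}=0$ otherwise; $T^{(\lambda)}=\mathrm{diag}(\delta_1^{(\lambda)},\dots,\delta_N^{(\lambda)})$. $L_0$ is the lower triangular matrix with $(L_0)_{j,k}=\frac{\mu_j}{\mu_k}\frac{(-a)^{j-k}}{(j-k)!}$ for $j\ge k$ and $0$ for $j<k$. *)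

(* Defs.v *)
From mathcomp Require Import all_boot all_order all_algebra.
From mathcomp Require Import all_classical all_reals all_analysis.
Set Implicit Arguments.
Unset Strict Implicit.
Unset Printing Implicit Defensive.
Import Order.TTheory GRing.Theory Num.Theory.
Import numFieldNormedType.Exports.
Local Open Scope classical_set_scope.
Local Open Scope ring_scope.

(* The mathematical index j in {1,..,N} is the ordinal i : 'I_N with
   j = i.+1; differences of indices are unaffected by this shift.  All the
   matrices involved are real, so that the adjoint is the transpose. *)

Section Defs.
Context {R : realType} {N : nat}.
Implicit Types (a : R) (mu : 'I_N -> R) (delta : nat -> 'I_N -> R).
Implicit Types (lambda x : nat).

(* When j = k.+1 the index of mu_(j-1) is k. *)
Definition matA mu : 'M[R]_N :=
  \matrix_(j, k) (if j == k.+1 :> nat then mu j / mu k else 0).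

Definition matT delta lambda : 'M[R]_N :=
  diag_mx (\row_j delta lambda j).

Definition matL0 a mu : 'M[R]_N :=
  \matrix_(j, k) (if (k <= j)%N
                  then mu j / mu k * ((- a) ^+ (j - k) / (j - k)`!%:R)
                  else 0).

Definition weight a mu delta lambda x : 'M[R]_N :=
  (a ^+ x / x`!%:R) *:
    ((1%:M + matA mu) ^+ (x + lambda) *m matT delta lambda
       *m (1%:M + (matA mu)^T) ^+ (x + lambda)).

(* Meaningful only when the series of matrices converges. *)
Definition moment0 a mu delta lambda : 'M[R]_N :=
  limn (series (weight a mu delta lambda)).

Definition matD0 a mu delta lambda : 'M[R]_N :=
  diag_mx (\row_j
    (mu j ^+ 2 * a ^+ j.+1 * expR a *
     \sum_(l < N | (l <= j)%N)
        (delta lambda l / mu l ^+ 2 * (a ^- l.+1 / (j - l)`!%:R)))).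

(* [is_trig_mx] is lower triangularity. *)
Definition is_LDU (H L D U : 'M[R]_N) : Prop :=
  [/\ H = L *m D *m U,
      is_trig_mx L /\ (forall i, L i i = 1),
      is_diag_mx D &
      is_trig_mx U^T /\ (forall i, U i i = 1)].

End Defs.

(* Main.v *)
Require Import Defs.
From mathcomp Require Import all_boot all_order all_algebra.
From mathcomp Require Import all_classical all_reals all_analysis.
From mathcomp Require Import ring.
Import Order.TTheory GRing.Theory Num.Theory.
Import numFieldNormedType.Exports.
Local Open Scope classical_set_scope.
Local Open Scope ring_scope.

(** Conjugating by [diag(mu)] turns [A] into the nilpotent lower shift, so each
    matrix built from [A] is a conjugated lower triangular Toeplitz matrix, and
    these multiply like polynomials truncated at degree [N] ([toepM]).  In this
    dictionary [A] is ['X], [(I + A)^n] is [('X + 1)^n], and [L0] is the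
    truncated exponential series of [- a 'X], i.e. [L0 = exp(- a A)].  Hence
    [L0^-1 = exp(a A)], and [L0^-1] commutes with [(I + A)^lambda].

    Pulling the powers [(I + A)^lambda] out of the moment leaves
    [sum_x a^x / x! (I + A)^x T ((I + A)^x)^T], which has to be shown to be
    [exp(a A) D0 exp(a A)^T] ([cvg_series_gram]).  The entries of [(I + A)^x]
    are [mu_j / mu_k * 'C(x, j - k)], so entry by entry this asks for the mixed
    binomial moments [sum_x a^x / x! 'C(x, p) 'C(x, q)] of a Poisson law.
    Vandermonde's convolution turns the product of binomials into a linear
    combination of single ones ([bin_mul_bin]), and
    [sum_x a^x / x! 'C(x, n) = e^a a^n / n!]; the result
    ([cvg_series_exp_bin_bin]) is [e^a] times the sum over [m] of
    [a^(p-m)/(p-m)! * a^(q-m)/(q-m)! * a^m/m!].  The first two factors are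
    entries of [exp(a A)] and the last one belongs to [D0]: the identity is
    itself a lower-diagonal-upper factorization.

    Unit triangularity of the outer factors only says that the polynomial
    [exp(a 'X) ('X + 1)^lambda] has constant coefficient [1]. *)

Set Implicit Arguments.
Unset Strict Implicit.
Unset Printing Implicit Defensive.

(** * Finite sums *)

Lemma sum_ord_interval (V : nmodType) (N j k : nat) (F : nat -> V) :
  (j < N)%N -> (k <= j)%N ->
  \sum_(i < N | (k <= i <= j)%N) F i = \sum_(m < (j - k).+1) F (m + k)%N.
Proof.
move=> jN kj; rewrite -(big_mkord predT (fun m => F (m + k)%N)) -subSn//.
rewrite -(big_addn 0 _ k predT) add0n (big_nat_widen _ _ _ _ _ jN).
by rewrite (big_nat_widenl k 0%N)// big_mkord; apply: eq_bigl => i;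
  rewrite andbC.
Qed.

(** This is [exp(c X) exp(d X) = exp((c + d) X)], read on the coefficient of
    [X^n]. *)
Lemma sum_exp_coeffM (F : numFieldType) (c d : F) n :
  \sum_(m < n.+1) (c ^+ (n - m) / (n - m)`!%:R) * (d ^+ m / m`!%:R) =
  (c + d) ^+ n / n`!%:R.
Proof.
have fact_neq0 m : m`!%:R != 0 :> F by rewrite pnatr_eq0 -lt0n fact_gt0.
rewrite exprDn mulr_suml; apply: eq_bigr => m _.
have mn : (m <= n)%N by rewrite -ltnS.
rewrite -(bin_fact mn) !natrM -mulr_natr.
have bin_neq0 : 'C(n, m)%:R != 0 :> F by rewrite pnatr_eq0 -lt0n bin_gt0.
by field; rewrite !fact_neq0.
Qed.

(** * Toeplitz matrices conjugated by a diagonal matrix *)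

Section ToeplitzConjugates.
Variables (F : fieldType) (N : nat) (mu : 'I_N -> F).

(** The value at [p] of the algebra morphism that sends ['X] to
    [diag(mu) * shift * diag(mu)^-1].  Giving the entries, rather than
    evaluating [p] at that matrix, makes triangularity and the comparison
    with explicit matrices immediate. *)
Definition toep (p : {poly F}) : 'M[F]_N :=
  \matrix_(j, k) (if (k <= j)%N then mu j / mu k * p`_(j - k) else 0).

(** The shift is nilpotent of index [N], so power series may be represented by
    any of their truncations of order at least [N]. *)
Lemma eq_toep (p q : {poly F}) :
  (forall i, (i < N)%N -> p`_i = q`_i) -> toep p = toep q.
Proof.
move=> pq; apply/matrixP => j k; rewrite !mxE pq//.
exact: leq_ltn_trans (leq_subr _ _) (ltn_ord j).
Qed.

Lemma toepD p q : toep (p + q) = toep p + toep q.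
Proof.
by apply/matrixP => j k; rewrite !mxE coefD; case: ifP; rewrite ?addr0 ?mulrDr.
Qed.

Lemma toep_trig p : is_trig_mx (toep p).
Proof. by apply/is_trig_mxP => i j ij; rewrite mxE leqNgt ij. Qed.

Hypothesis mu_neq0 : forall j, mu j != 0.

Lemma toep_diag p i : toep p i i = p`_0.
Proof. by rewrite mxE leqnn subnn divff ?mul1r. Qed.

Lemma toep1 : toep 1 = 1%:M.
Proof.
apply/matrixP => j k; rewrite !mxE coef1 subn_eq0.
have [<-|jk] := eqVneq j k; first by rewrite leqnn divff ?mul1r.
by case: ltngtP (jk : j != k :> nat) => //=; rewrite mulr0.
Qed.

(** The factors [mu i] telescope, which leaves the Cauchy product. *)
Lemma toepM p q : toep (p * q) = toep p *m toep q.
Proof.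
apply/matrixP => j k; rewrite !mxE.
transitivity (\sum_(i < N | (k <= i <= j)%N)
                mu j / mu k * (p`_(j - i) * q`_(i - k))); last first.
  rewrite big_mkcond; apply: eq_bigr => i _; rewrite !mxE.
  case: (leqP k i) => ki /=; last by rewrite mulr0.
  case: (leqP i j) => ij /=; last by rewrite mul0r.
  by field; rewrite !mu_neq0.
case: leqP => kj; last first.
  rewrite big_pred0// => i; apply/negbTE/negP => /andP[ki ij].
  by move: (leq_trans ki ij); rewrite leqNgt kj.
rewrite -mulr_sumr (sum_ord_interval (fun i => p`_(j - i) * q`_(i - k)))//.
congr (_ * _); rewrite coefMr; apply: eq_bigr => m _.
by rewrite addnK addnC subnDA.
Qed.

Lemma toepX p n : toep (p ^+ n) = toep p ^+ n.
Proof.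
by elim: n => [|n IHn]; rewrite ?toep1// exprS toepM IHn exprS.
Qed.

End ToeplitzConjugates.


(** * Binomial moments of the Poisson law *)

Section PoissonFactorialMoments.
Variable R : realType.

Lemma cvg_sumr (I : finType) (P : pred I) (u : I -> R^nat) (l : I -> R) :
  (forall i, P i -> u i n @[n --> \oo] --> l i) ->
  (\sum_(i | P i) u i n) @[n --> \oo] --> \sum_(i | P i) l i.
Proof. by move=> ul; apply: cvg_big => //; exact: add_continuous. Qed.

Lemma cvg_series_lincomb (I : finType) (P : pred I) (c : I -> R)
    (u : I -> R^nat) (l : I -> R) :
  (forall i, P i -> series (u i) @ \oo --> l i) ->
  series (fun x => \sum_(i | P i) c i * u i x) @ \oo -->
  \sum_(i | P i) c i * l i.
Proof.
move=> ul.
have -> : series (fun x => \sum_(i | P i) c i * u i x) =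
    (fun n => \sum_(i | P i) c i * series (u i) n).
  apply/funext => n; rewrite /series /= exchange_big/=.
  by apply: eq_bigr => i _; rewrite mulr_sumr.
by apply: cvg_sumr => i Pi; apply: cvgM; [exact: cvg_cst|exact: ul].
Qed.

(** Since ['C(x, n) / x! = 1 / (n! (x - n)!)], this is the exponential series
    shifted by [n]. *)
Lemma cvg_series_exp_bin (a : R) n :
  series (fun x => exp_coeff a x * 'C(x, n)%:R) @ \oo -->
  expR a * (a ^+ n / n`!%:R).
Proof.
rewrite -(cvg_shiftn n).
have -> : [sequence series (fun x => exp_coeff a x * 'C(x, n)%:R) (x + n)%N]_x =
    (fun x => series (exp_coeff a) x * (a ^+ n / n`!%:R)).
  apply/funext => x; rewrite /series /= (@big_cat_nat _ _ _ n) ?leq_addl//=.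
  rewrite big_nat_cond big1 ?add0r; last first.
    by move=> i; rewrite andbT => /andP[_ ni]; rewrite bin_small// mulr0.
  rewrite -{1}[n]add0n big_addn addnK mulr_suml; apply: eq_bigr => m _.
  have fact_neq0 k : k`!%:R != 0 :> R by rewrite pnatr_eq0 -lt0n fact_gt0.
  rewrite /exp_coeff /= -(bin_fact (leq_addl m n)) addnK !natrM exprD.
  have bin_neq0 : 'C(m + n, n)%:R != 0 :> R.
    by rewrite pnatr_eq0 -lt0n bin_gt0 leq_addl.
  by field; rewrite !fact_neq0.
by apply: cvgM; [exact: is_cvg_series_exp_coeff|exact: cvg_cst].
Qed.

(** Both sides count the pairs of disjoint subsets of sizes [p] and [r] in a set
    of size [x]. *)
Lemma bin_mul_binB x p r : (p <= x)%N ->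
  ('C(x, p) * 'C(x - p, r) = 'C(p + r, p) * 'C(x, p + r))%N.
Proof.
move=> px; have [xpr|prx] := ltnP x (p + r).
  by rewrite (bin_small xpr) (bin_small (_ : x - p < r)%N) ?muln0// ltn_subLR.
have rxp : (r <= x - p)%N by rewrite leq_subRL.
have fact_pos : (0 < p`! * r`! * (x - p - r)`!)%N.
  by rewrite !muln_gt0 !fact_gt0.
apply/eqP; rewrite -(eqn_pmul2r fact_pos); apply/eqP.
transitivity x`!.
  by rewrite -(bin_fact px) -(bin_fact rxp); ring.
rewrite -(bin_fact prx) -(bin_fact (leq_addr r p)) addKn subnDA; ring.
Qed.

(** Count pairs of subsets of sizes [p] and [q] according to the size [m] of
    their intersection: choose the union, of size [p + (q - m)], then the first
    set inside it, then the intersection inside the first set.  The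
    dependence on [x] becomes linear in single binomial coefficients, to which
    [cvg_series_exp_bin] applies. *)
Lemma bin_mul_bin x p q :
  ('C(x, p) * 'C(x, q) =
   \sum_(m < (minn p q).+1)
     'C(p, m) * 'C(p + (q - m), p) * 'C(x, p + (q - m)))%N.
Proof.
have [xp|px] := ltnP x p.
  rewrite bin_small// mul0n big1// => m _.
  by rewrite (bin_small (leq_trans xp (leq_addr _ p))) muln0.
rewrite -[in 'C(x, q)](subnKC px) -binomial.Vandermonde big_distrr/=.
rewrite (big_ord_widen q.+1 (fun m =>
  'C(p, m) * 'C(p + (q - m), p) * 'C(x, p + (q - m)))%N); last first.
  by rewrite ltnS geq_minr.
rewrite [in RHS]big_mkcond/=; apply: eq_bigr => m _.
rewrite ltnS leq_min -(ltnS m q) ltn_ord andbT.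
case: leqP => [mp|pm]; last by rewrite (bin_small pm) mul0n muln0.
by rewrite mulnCA bin_mul_binB// mulnA.
Qed.

(** The summand is written as a product of three exponential coefficients
    because these are the entries of the three factors of the LDU form. *)
Lemma cvg_series_exp_bin_bin (a : R) p q :
  series (fun x => exp_coeff a x * ('C(x, p)%:R * 'C(x, q)%:R)) @ \oo -->
  expR a * \sum_(m < (minn p q).+1)
    a ^+ (p - m) / (p - m)`!%:R * (a ^+ (q - m) / (q - m)`!%:R)
     * (a ^+ m / m`!%:R).
Proof.
have fact_neq0 k : k`!%:R != 0 :> R by rewrite pnatr_eq0 -lt0n fact_gt0.
pose c (m : 'I_(minn p q).+1) : R := ('C(p, m) * 'C(p + (q - m), p))%:R.
have -> : (fun x => exp_coeff a x * ('C(x, p)%:R * 'C(x, q)%:R)) =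
    (fun x => \sum_m c m * (exp_coeff a x * 'C(x, p + (q - m))%:R)).
  apply/funext => x; rewrite -natrM bin_mul_bin natr_sum mulr_sumr.
  by apply: eq_bigr => m _; rewrite [in LHS]natrM mulrCA.
rewrite mulr_sumr.
have -> : \sum_(m < (minn p q).+1) expR a *
     (a ^+ (p - m) / (p - m)`!%:R * (a ^+ (q - m) / (q - m)`!%:R)
     * (a ^+ m / m`!%:R)) =
  \sum_(m < (minn p q).+1) c m *
     (expR a * (a ^+ (p + (q - m)) / (p + (q - m))`!%:R)).
  apply: eq_bigr => m _.
  have mp : (m <= p)%N by rewrite (leq_trans _ (geq_minl p q))// -ltnS.
  rewrite /c natrM -(bin_fact (leq_addr (q - m) p)) addKn exprD.
  have -> : a ^+ p = a ^+ (p - m) * a ^+ m by rewrite -exprD subnK.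
  have bin_neq0' : 'C(p, m)%:R != 0 :> R by rewrite pnatr_eq0 -lt0n bin_gt0.
  rewrite -(bin_fact mp) !natrM.
  have bin_neq0 : 'C(p + (q - m), p)%:R != 0 :> R.
    by rewrite pnatr_eq0 -lt0n bin_gt0 leq_addr.
  by field; rewrite !fact_neq0 bin_neq0 bin_neq0'.
by apply: cvg_series_lincomb => m _; exact: cvg_series_exp_bin.
Qed.

End PoissonFactorialMoments.

(** * Limits of matrices *)

Section MatrixLimits.
Variable R : realType.

Lemma cvg_mx_coord m n (u : nat -> 'M[R]_(m, n)) (l : 'M[R]_(m, n)) :
  (forall i j, u x i j @[x --> \oo] --> l i j) -> u @ \oo --> l.
Proof.
move=> ul A [P lP PA].
have : \forall x \near \oo, forall i j, P i j (u x i j).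
  by apply: filter_forall => i; apply: filter_forall => j; exact: ul.
by apply: filterS => x Px; exact: PA.
Qed.

Lemma cvg_mulmx_cst m n p q (B : 'M[R]_(m, n)) (C : 'M[R]_(p, q))
    (u : nat -> 'M[R]_(n, p)) (l : 'M[R]_(n, p)) :
  u @ \oo --> l -> B *m u x *m C @[x --> \oo] --> B *m l *m C.
Proof.
move=> ul; apply: cvg_mx_coord => i j; rewrite mxE; under eq_cvg do rewrite mxE.
apply: cvg_sumr => k _; apply: cvgM; last exact: cvg_cst.
rewrite mxE; under eq_cvg do rewrite mxE.
apply: cvg_sumr => k' _; apply: cvgM; first exact: cvg_cst.
apply: (cvg_comp u (fun M : 'M[R]_(n, p) => M k' k) ul).
exact: coord_continuous.
Qed.

Lemma series_mx_coord m n (u : nat -> 'M[R]_(m, n)) i j x :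
  series u x i j = series (fun y => u y i j) x.
Proof. by rewrite /series /= summxE. Qed.

End MatrixLimits.

(** * The zeroth moment *)

Lemma trmxX (R : comNzRingType) n (A : 'M[R]_n) k : (A ^+ k)^T = A^T ^+ k.
Proof.
elim: k => [|k IHk]; first exact: trmx1.
by rewrite exprS [RHS]exprSr -IHk; exact: trmx_mul.
Qed.

Section Moment.
Variables (R : realType) (N : nat) (mu : 'I_N -> R).
Hypothesis mu_neq0 : forall j, mu j != 0.

(** [exp(c A)]: since [A ^+ N = 0], the truncation at degree [N] is exact. *)
Definition toep_exp (c : R) : 'M[R]_N :=
  toep mu (\poly_(i < N) (c ^+ i / i`!%:R)).

Lemma toep_expE c (j k : 'I_N) : toep_exp c j k =
  if (k <= j)%N then mu j / mu k * (c ^+ (j - k) / (j - k)`!%:R) else 0.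
Proof.
by rewrite mxE coef_poly (leq_ltn_trans (leq_subr _ _) (ltn_ord j)).
Qed.

Lemma toep_exp0 : toep_exp 0 = 1%:M.
Proof.
rewrite -(toep1 mu_neq0); apply: eq_toep => i iN.
rewrite coef_poly iN coef1 expr0n.
by case: i iN => [|i] _ /=; rewrite ?fact0 ?divr1// mul0r.
Qed.

Lemma toep_expD c d : toep_exp (c + d) = toep_exp c *m toep_exp d.
Proof.
rewrite -(toepM mu_neq0); apply: eq_toep => i iN.
rewrite coef_poly iN coefMr -sum_exp_coeffM; apply: eq_bigr => m _.
rewrite !coef_poly (leq_ltn_trans (leq_subr _ _) iN).
by rewrite (leq_ltn_trans _ iN)// -ltnS.
Qed.

Lemma matL0_toep_exp a : matL0 a mu = toep_exp (- a).
Proof. by apply/matrixP => j k; rewrite toep_expE mxE. Qed.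

Lemma matL0_unit a : matL0 a mu \in unitmx.
Proof.
by have /mulmx1_unit[] : matL0 a mu *m toep_exp a = 1%:M;
  rewrite matL0_toep_exp// -toep_expD addNr toep_exp0.
Qed.

Lemma invmx_matL0 a : invmx (matL0 a mu) = toep_exp a.
Proof.
apply: (can_inj (mulKmx (matL0_unit a))).
by rewrite mulmxV ?matL0_unit// matL0_toep_exp -toep_expD addNr toep_exp0.
Qed.

Lemma matA_toep : matA mu = toep mu 'X.
Proof.
apply/matrixP => j k; rewrite !mxE coefX.
have [->|jk] := eqVneq (j : nat) k.+1; first by rewrite leqnSn subSnn mulr1.
case: leqP => // kj; case: eqP => [jk1|]; last by rewrite mulr0.
by move: jk; rewrite -(subnK kj) jk1 eqxx.
Qed.

Lemma exp_1DmatA n : (1%:M + matA mu) ^+ n = toep mu (('X + 1) ^+ n).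
Proof. by rewrite matA_toep -(toep1 mu_neq0) -toepD addrC toepX. Qed.

Lemma exp_1DmatAE n (j k : 'I_N) : ((1%:M + matA mu) ^+ n) j k =
  if (k <= j)%N then mu j / mu k * 'C(n, j - k)%:R else 0.
Proof.
rewrite exp_1DmatA mxE; case: ifP => // _; congr (_ * _).
rewrite exprD1n coef_sum.
under eq_bigr do rewrite coefMn coefXn.
have [jkn|jkn] := ltnP (j - k) n.+1.
  rewrite (bigD1 (Ordinal jkn))//= eqxx big1 ?addr0// => i /negPf ijk.
  by rewrite eq_sym -val_eqE /= in ijk *; rewrite ijk mul0rn.
rewrite bin_small// big1// => i _.
by rewrite gtn_eqF ?mul0rn// (leq_trans (ltn_ord i)).
Qed.

Lemma exp_1DtrmatA n :
  (1%:M + (matA mu)^T) ^+ n = ((1%:M + matA mu) ^+ n)^T.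
Proof. by rewrite trmxX linearD /= trmx1. Qed.

Variables (a : R) (delta : nat -> 'I_N -> R) (lambda : nat).
Hypothesis a_neq0 : a != 0.

(** The moment with the powers [lambda] pulled out.  On both sides the entry
    [(j, k)] is a combination over [l <= min(j, k)] with coefficients
    [c l = mu_j mu_k delta_l / mu_l^2]; comparing them is
    [cvg_series_exp_bin_bin] for [p = j - l] and [q = k - l], once the index [i]
    of the diagonal factor is written [i = l + m]. *)
Lemma cvg_series_gram :
  series (fun x => exp_coeff a x *:
    ((1%:M + matA mu) ^+ x *m matT delta lambda
       *m ((1%:M + matA mu) ^+ x)^T)) @ \oo -->
  toep_exp a *m matD0 a mu delta lambda *m (toep_exp a)^T.
Proof.
have fact_neq0 k : k`!%:R != 0 :> R by rewrite pnatr_eq0 -lt0n fact_gt0.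
apply: cvg_mx_coord => j k; under eq_cvg do rewrite series_mx_coord.
pose P (l : 'I_N) := (l <= minn j k)%N.
pose c (l : 'I_N) := mu j * mu k * delta lambda l / mu l ^+ 2.
have -> : (fun x => (exp_coeff a x *: ((1%:M + matA mu) ^+ x *m
      matT delta lambda *m ((1%:M + matA mu) ^+ x)^T)) j k) =
    (fun x => \sum_(l | P l) c l *
      (exp_coeff a x * ('C(x, j - l)%:R * 'C(x, k - l)%:R))).
  apply/funext => x; rewrite mxE [X in _ * X]mxE mulr_sumr [RHS]big_mkcond.
  apply: eq_bigr => l _; rewrite mul_mx_diag !mxE !exp_1DmatAE /P leq_min.
  case: (leqP l j) => _ /=; last by rewrite !mul0r mulr0.
  case: (leqP l k) => _ /=; last by rewrite !mulr0.
  by rewrite /c; field; rewrite mu_neq0.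
pose G (l : 'I_N) (i : nat) := a ^+ (j - i) / (j - i)`!%:R
  * (a ^+ (k - i) / (k - i)`!%:R) * (a ^+ (i - l) / (i - l)`!%:R).
have -> : (toep_exp a *m matD0 a mu delta lambda *m (toep_exp a)^T) j k =
    \sum_(l | P l) c l * (expR a * \sum_(m < (minn (j - l) (k - l)).+1)
      a ^+ (j - l - m) / (j - l - m)`!%:R
      * (a ^+ (k - l - m) / (k - l - m)`!%:R) * (a ^+ m / m`!%:R)).
  transitivity (\sum_(l | P l) c l * (expR a *
      \sum_(i < N | (l <= i <= minn j k)%N) G l i)); last first.
    apply: eq_bigr => l Pl; rewrite sum_ord_interval//; last first.
      by rewrite (leq_ltn_trans (geq_minl _ _)).
    rewrite subn_minl; congr (_ * (_ * _)); apply: eq_bigr => m _.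
    by rewrite /G addnK addnC !subnDA.
  (* The inner sum comes from the diagonal entry, so it is the sum over the
     diagonal index that has to be moved inside. *)
  transitivity (\sum_(i < N | (i <= minn j k)%N) \sum_(l < N | (l <= i)%N)
      c l * expR a * G l i).
    have := toep_expE a; move: (toep_exp a) => E EE.
    rewrite mxE [RHS]big_mkcond; apply: eq_bigr => i _.
    rewrite /matD0 mul_mx_diag !mxE !EE leq_min.
    case: (leqP i j) => ij /=; last by rewrite !mul0r.
    case: (leqP i k) => ik /=; last by rewrite !mulr0.
    rewrite !mulr_sumr mulr_suml; apply: eq_bigr => l li.
    have -> : a ^+ i.+1 = a ^+ (i - l) * a ^+ l.+1.
      by rewrite -exprD addnS subnK.
    by rewrite /c /G; field; rewrite !fact_neq0 !mu_neq0 expf_neq0.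
  rewrite (exchange_big_dep P) /=; last first.
    by move=> i l ijk li; exact: leq_trans li ijk.
  apply: eq_bigr => l _; rewrite mulrA mulr_sumr.
  by apply: eq_bigl => i; rewrite andbC.
by apply: cvg_series_lincomb => l _; exact: cvg_series_exp_bin_bin.
Qed.

Lemma cvg_series_weight :
  series (weight a mu delta lambda) @ \oo -->
  (1%:M + matA mu) ^+ lambda
    *m (toep_exp a *m matD0 a mu delta lambda *m (toep_exp a)^T)
    *m ((1%:M + matA mu) ^+ lambda)^T.
Proof.
have -> : series (weight a mu delta lambda) =
    (fun n => (1%:M + matA mu) ^+ lambda *m
     series (fun x => exp_coeff a x *:
       ((1%:M + matA mu) ^+ x *m matT delta lambda
          *m ((1%:M + matA mu) ^+ x)^T)) n *m ((1%:M + matA mu) ^+ lambda)^T).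
  apply/funext => n; rewrite /series /= mulmx_sumr mulmx_suml.
  apply: eq_bigr => x _.
  rewrite -scalemxAr -scalemxAl /weight exp_1DtrmatA addnC exprD.
  by rewrite -[X in X^T]/(_ *m _) trmx_mul !mulmxA.
by apply: cvg_mulmx_cst; exact: cvg_series_gram.
Qed.

End Moment.

Theorem proposition5p6 (R : realType) (N : nat) (hN : (1 <= N)%N)
    (a : R) (ha : 0 < a) (lambda : nat)
    (mu : 'I_N -> R) (hmu : forall j, 0 < mu j)
    (delta : nat -> 'I_N -> R) (hdelta : forall l j, 0 < delta l j) :
  [/\ cvgn (series (weight a mu delta lambda)),
      matL0 a mu \in unitmx &
      is_LDU (moment0 a mu delta lambda)
        (invmx (matL0 a mu) *m (1%:M + matA mu) ^+ lambda)
        (matD0 a mu delta lambda)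
        ((1%:M + (matA mu)^T) ^+ lambda *m invmx (matL0 a mu)^T)].
Proof.
have mu_neq0 j : mu j != 0 by rewrite gt_eqF.
have a_neq0 : a != 0 by rewrite gt_eqF.
have cvgW := @cvg_series_weight _ _ _ mu_neq0 _ delta lambda a_neq0.
have [p Lp p0] : exists2 p, invmx (matL0 a mu) *m (1%:M + matA mu) ^+ lambda
    = toep mu p & p`_0 = 1.
  exists (\poly_(i < N) (a ^+ i / i`!%:R) * ('X + 1) ^+ lambda).
    by rewrite (toepM mu_neq0) (exp_1DmatA mu_neq0) invmx_matL0.
  rewrite coefM big_ord1 coef_poly hN subnn expr0 fact0 divr1 mul1r.
  by rewrite -horner_coef0 horner_exp hornerD hornerX hornerC add0r expr1n.
have UE : (1%:M + (matA mu)^T) ^+ lambda *m invmx (matL0 a mu)^T =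
    (invmx (matL0 a mu) *m (1%:M + matA mu) ^+ lambda)^T.
  by rewrite trmx_mul exp_1DtrmatA trmx_inv.
split; [by apply/cvg_ex; eexists; exact: cvgW|exact: matL0_unit|].
have LC : invmx (matL0 a mu) *m (1%:M + matA mu) ^+ lambda =
    (1%:M + matA mu) ^+ lambda *m toep_exp mu a.
  by rewrite invmx_matL0// (exp_1DmatA mu_neq0) -!(toepM mu_neq0) mulrC.
split.
- rewrite UE LC trmx_mul !mulmxA /moment0 (cvg_lim _ cvgW) ?mulmxA//.
- by rewrite Lp; split=> [|i]; [exact: toep_trig|rewrite toep_diag].
- exact: diag_mx_is_diag.
- rewrite UE trmxK Lp; split=> [|i]; first exact: toep_trig.
  by rewrite mxE toep_diag.
Qed.
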